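(* Let $m$ be the Lebesgue measure, let $\gamma:[0,1]\to\mathbb{R}$ be nondecreasing, concave and continuous on $[0,1]$ with $\gamma(0)=0$, and let $\mu$ be the distorted Lebesgue measure $\mu(A)=\gamma(m(A))$. Then the Volterra-Choquet operator $V:C[0,1]\to C[0,1]$ defined by $V(f)(x)=(C)\int_{0}^{x}f(t)\,d\mu(t)$, $x\in[0,1]$, is a nonlinear compact operator.
   Context: The set function $\mu$ is defined on the $\sigma$-algebra $\mathcal{C}$ of Borel subsets (or alternatively of Lebesgue measurable subsets) of $[0,1]$. The space $C[0,1]$ consists of the continuous real-valued functions on $[0,1]$ with the uniform norm. Choquet integral: for a monotone set function $\mu$ on $\mathcal{C}$ (i.e. $\mu(\emptyset)=0$ and $\mu(A)\le\mu(B)$ for $A\subset B$), $f:[0,1]\to\mathbb{R}$ $\mathcal{C}$-measurable and $A\in\mathcal{C}$, $$(C)\int_{A}f\,d\mu=\int_{0}^{+\infty}\mu(\{\omega\in A: f(\omega)\ge\beta\})\,d\beta+\int_{-\infty}^{0}\left[\mu(\{\omega\in A: f(\omega)\ge\beta\})-\mu(A)\right]d\beta ,$$ and $(C)\int_0^x$ means $(C)\int_{[0,x]}$. Compactness: a (not necessarily linear) operator $A:X\to Y$ between metric spaces is compact if it is continuous on $X$ and, for every bounded $M\subset X$, the set $A(M)$ is relatively compact in $Y$ (its closure is compact in $Y$). *)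

(* Defs.v *)
From HB Require Import structures.
From mathcomp Require Import all_boot all_order all_algebra.
From mathcomp Require Import all_classical all_reals all_analysis.

Set Implicit Arguments.
Unset Strict Implicit.
Unset Printing Implicit Defensive.

Import Order.TTheory GRing.Theory Num.Theory.
Import numFieldNormedType.Exports.

Local Open Scope classical_set_scope.
Local Open Scope ring_scope.
Local Open Scope convex_scope.

(* set_type carries the subset topology. *)
Notation I01 R := (set_type (`[0 : R, 1]%classic)).

Definition C01 (R : realType) : Type := continuousType (I01 R) R.

Definition C01_fun (R : realType) (f : C01 R) : I01 R -> R := f.
Coercion C01_fun : C01 >-> Funclass.

HB.instance Definition _ (R : realType) := gen_eqMixin (C01 R).
HB.instance Definition _ (R : realType) := gen_choiceMixin (C01 R).

Definition uniform_norm (R : realType) (h : I01 R -> R) : R :=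
  sup [set `|h x| | x in [set: I01 R]].

Section C01_metric.
Variable R : realType.
Implicit Types f g h : C01 R.

Definition C01_dist f g : R := uniform_norm (fun x => f x - g x).

Let zero01 : I01 R.
Proof. by exists 0; apply/mem_set; rewrite /= in_itv /= lexx ler01. Qed.

Let dist_nonempty f g : [set `|f x - g x| | x in [set: I01 R]] !=set0.
Proof. by exists `|f zero01 - g zero01|; exists zero01. Qed.

Let dist_ubound f g : has_ubound [set `|f x - g x| | x in [set: I01 R]].
Proof.
pose h : I01 R -> R := fun x => `|f x - g x|.
have hc : continuous h.
  move=> x.
  have fx := @cts_fun _ _ (f : continuousType _ _) x.
  have gx := @cts_fun _ _ (g : continuousType _ _) x.
  exact: (continuous_comp (continuousB fx gx) (@norm_continuous _ _ _)).
have [c _ hM] := EVT_max ler01 ((@subspace_valL_continuousP _ _ _ h).2 hc).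
exists (valL h c) => _ [x _ <-].
have x01 : val x \in `[(0 : R), 1] by have := valP x; rewrite inE.
have := hM _ x01.
by rewrite -[valL h (val x)]/(sigL _ (valL h) x) valLK.
Qed.

Lemma C01_dist_ge f g x : `|f x - g x| <= C01_dist f g.
Proof. by apply: ub_le_sup; [exact: dist_ubound | exists x]. Qed.

Let C01_dist_le f g r : (forall x, `|f x - g x| <= r) -> C01_dist f g <= r.
Proof. by move=> fg; apply: ge_sup => // _ [x _ <-]. Qed.

Let C01_distxx f : C01_dist f f = 0.
Proof.
apply/eqP; rewrite eq_le; apply/andP; split.
  by apply: C01_dist_le => x; rewrite subrr normr0.
exact: le_trans (C01_dist_ge f f zero01).
Qed.

Let C01_dist_positivity f g : C01_dist f g = 0 -> f = g.
Proof.
move=> fg0; apply/continuousEP => x.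
by have := C01_dist_ge f g x; rewrite fg0 normr_le0 subr_eq0 => /eqP.
Qed.

Let C01_dist_sym f g : C01_dist f g = C01_dist g f.
Proof.
by apply/eqP; rewrite eq_le; apply/andP; split; apply: C01_dist_le => x;
  rewrite distrC; exact: C01_dist_ge.
Qed.

Let C01_dist_triangle g f h :
  C01_dist f h <= C01_dist f g + C01_dist g h.
Proof.
apply: C01_dist_le => x; apply: le_trans (ler_distD (g x) _ _) _.
by apply: lerD; exact: C01_dist_ge.
Qed.

HB.instance Definition _ := isMetric.Build R (C01 R)
  C01_distxx C01_dist_positivity C01_dist_sym C01_dist_triangle.

End C01_metric.

Definition metric_bounded (R : realType) (X : metricType R) (M : set X) :=
  exists r : R, forall x y, M x -> M y -> mdist x y <= r.

Definition compact_operator (R : realType) (X Y : metricType R) (A : X -> Y) :=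
  continuous A /\
  forall M : set X, metric_bounded M -> compact (closure (A @` M)).

(* Library [convex_function] with the inequality reversed. *)
Definition concave_function (R : realType) (D : set R^o) (f : R^o -> R^o) :=
  forall t : {i01 R},
    {in D &, forall x y : R^o, (f x <| t |> f y <= f (x <| t |> y))%R}.

(* The integrands are monotone in b, so the Lebesgue integrals over b agree with
   the improper Riemann ones.  The value is extended real: equating it with a
   real number asserts that both integrals are finite.  The set function mu is
   total, but only its values on A and on the level sets of f in A matter; it is
   meant to be monotone with mu set0 = 0. *)
Definition choquet (R : realType) (T : Type) (mu : set T -> R) (A : set T)
    (f : T -> R) : \bar R :=
  (\int[lebesgue_measure]_(b in `[0%R, +oo[) (mu [set w | A w /\ (b <= f w)%R])%:E
   + \int[lebesgue_measure]_(b in `]-oo, 0%R])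
       (mu [set w | A w /\ (b <= f w)%R] - mu A)%:E)%E.

(* gamma is only evaluated on [0, 1], and fine is harmless there since the measure
   of a part of [0, 1] is at most 1.  A is a Borel set of I01 R when its image
   in R is; on other sets lebesgue_measure is the outer measure. *)
Definition distorted_lebesgue (R : realType) (gamma : R -> R)
    (A : set (I01 R)) : R :=
  gamma (fine (lebesgue_measure [set val x | x in A])).

(* Main.v *)
Require Import Defs.
From HB Require Import structures.
From mathcomp Require Import all_boot all_order all_algebra.
From mathcomp Require Import all_classical all_reals all_analysis.
From mathcomp Require Import measurable_realfun lra.

Import Order.TTheory GRing.Theory Num.Theory.
Import numFieldNormedType.Exports.

Local Open Scope classical_set_scope.
Local Open Scope ring_scope.

(* If |f| <= K then V f x is the integral of the level function
   b |-> mu {t <= x | b <= f t} over [-K, K], minus K * mu [0, x].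
   - Translating b by a constant c shows that |f - g| <= c implies
     |V f - V g| <= c * gamma 1, so V is Lipschitz.
   - Concavity and gamma 0 = 0 make gamma subadditive, so moving x to y changes
     the level function by at most gamma |x - y|; hence
     |V f x - V f y| <= 3 K gamma |x - y|.
   V thus maps bounded sets to bounded equicontinuous sets, and the
   Arzela-Ascoli theorem concludes. *)

(** * Translation invariance of Lebesgue measure, and integrals over segments *)

Section lebesgue_measure_shift.
Context (R : realType) (c : R).
Local Notation mu := (@lebesgue_measure R).
Local Notation shiftc := (fun x : measurableTypeR R => x + c : measurableTypeR R).

Let mshiftc : measurable_fun setT shiftc.
Proof. exact: measurable_funD. Qed.

Let shift_mfun : {mfun _ >-> _} :=
  HB.pack shiftc (isMeasurableFun.Build _ _ _ _ _ mshiftc).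

(** A measure giving each half-open interval its length is Lebesgue measure, and translation
    preserves lengths. *)
Lemma lebesgue_measure_shift A :
  measurable A -> pushforward mu shiftc A = mu A.
Proof.
move=> mA; apply/esym.
apply: (lebesgue_measure_unique (mu := pushforward mu shift_mfun)) => //= _ [[a b]] _ <-.
have -> : pushforward mu shiftc `]a, b]%classic = mu `](a - c), (b - c)]%classic.
  by congr (mu _); apply/seteqP; split => x /=;
    rewrite !in_itv/= ltrBlDr lerBrDr.
by rewrite !lebesgue_measure_itv/= !lte_fin ltrD2r -!EFinB opprD addrACA subrr addr0.
Qed.

Lemma ge0_integral_itv_shift (a b : R) (f : R -> \bar R) :
  measurable_fun [set: R] f -> (forall x, 0 <= f x)%E ->
  (\int[mu]_(x in `[a, b]) f x =
   \int[mu]_(x in `[(a - c)%R, (b - c)%R]) f (x + c)%R)%E.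
Proof.
move=> mf f0.
rewrite (@eq_measure_integral _ _ _ _ (pushforward mu shift_mfun)); last first.
  by move=> X mX _; exact/esym/lebesgue_measure_shift.
rewrite ge0_integral_pushforward//; last exact: measurable_funTS.
by congr (integral _ _ _); apply/seteqP; split => x /=;
  rewrite !in_itv/= lerBlDr lerBrDr.
Qed.

End lebesgue_measure_shift.

Lemma nonincreasing_itv_integrable (R : realType) (F : R -> R) (a b : R) :
  nonincreasing_fun F ->
  lebesgue_measure.-integrable `[a, b] (EFin \o F).
Proof.
move=> dF; apply: measurable_bounded_integrable => //.
- by rewrite /= lebesgue_measure_itv/=; case: ifPn => // _; rewrite ltry.
- by apply: measurable_funTS; exact: nonincreasing_measurable.
(* Monotonicity traps [F x] between [F b] and [F a]. *)
- exists (`|F a| + `|F b|); split; first exact: num_real.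
  move=> M ltM x /=; rewrite in_itv/= => /andP[ax xb].
  rewrite (le_trans _ (ltW ltM))//.
  have := dF _ _ ax; have := dF _ _ xb.
  by move: (F x) (F a) (F b) => u v w; rewrite ler_norml => ? ?;
    have := ler_norm v; have := ler_norm (- w); rewrite normrN => ? ?;
    have := normr_ge0 v; have := normr_ge0 w; lra.
Qed.

Lemma Rintegral_cst_itv (R : realType) (r a b : R) : a <= b ->
  \int[lebesgue_measure]_(x in `[a, b]) r = r * (b - a).
Proof.
move=> ab; rewrite Rintegral_cst//= lebesgue_measure_itv/= lte_fin.
by case: ltgtP ab => //= -> _; rewrite subrr.
Qed.

(** * Choquet integrals of bounded functions for a monotone set function *)

Section choquet_bounded.
Context (R : realType) (T : Type) (mu : set T -> R).
Hypotheses (mu0 : mu set0 = 0) (le_mu : {homo mu : X Y / X `<=` Y >-> X <= Y}).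
Local Notation level A f := (fun b : R => mu [set w | A w /\ b <= f w]).
Implicit Types (A B : set T) (f g : T -> R).

Lemma setfun_ge0 A : 0 <= mu A.
Proof. by rewrite -mu0 le_mu. Qed.

Lemma nonincreasing_level A f : nonincreasing_fun (level A f).
Proof.
by move=> x y xy; apply: le_mu => w /= [Aw yf]; split=> //; exact: le_trans yf.
Qed.

Lemma level_le A f b : level A f b <= mu A.
Proof. by apply: le_mu => w []. Qed.

Lemma level_integrable A f a b :
  lebesgue_measure.-integrable `[a, b] (EFin \o level A f).
Proof. exact/nonincreasing_itv_integrable/nonincreasing_level. Qed.

(** Level sets are empty above [b] and equal to [A] below [a], so both integrands vanish outside
    [[a, b]]. Integrating [- mu A] over [[a, 0]] yields the term [a * mu A]. The window [[a, b]] is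
    left free so that two functions can be compared on different windows. *)
Lemma choquetE A f (a b : R) : a <= 0 -> 0 <= b ->
  (forall t, A t -> a <= f t <= b) ->
  choquet mu A f =
  (\int[lebesgue_measure]_(x in `[a, b]) level A f x + a * mu A)%:E.
Proof.
move=> a0 b0 fab; set F := level A f.
have Fge x : b < x -> F x = 0.
  move=> bx; rewrite /F (_ : [set _ | _] = set0)//; apply/seteqP; split => // w.
  by move=> [/fab/andP[_ fb] xf]; have := le_lt_trans (le_trans xf fb) bx;
    rewrite ltxx.
have Fle x : x <= a -> F x = mu A.
  move=> xa; congr mu; apply/seteqP; split => [w []//|w Aw]; split => //.
  by case/andP: (fab _ Aw) => af _; exact: le_trans af.
transitivity (\int[lebesgue_measure]_(x in `[0%R, +oo[) (F x)%:E +
    \int[lebesgue_measure]_(x in `]-oo, 0%R]) (F x - mu A)%:E)%E; first by [].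
have -> : (\int[lebesgue_measure]_(x in `[0%R, +oo[) (F x)%:E =
    \int[lebesgue_measure]_(x in `[0%R, b]) (F x)%:E)%E.
  rewrite [LHS]integral_mkcond [RHS]integral_mkcond; apply: eq_integral => x _.
  rewrite !patchE !mem_setE !in_itv/= andbT; case: (leP 0 x) => //= x0.
  by case: leP => // /Fge ->.
have -> : (\int[lebesgue_measure]_(x in `]-oo, 0%R]) (F x - mu A)%:E =
    \int[lebesgue_measure]_(x in `[a, 0%R]) (F x - mu A)%:E)%E.
  rewrite [LHS]integral_mkcond [RHS]integral_mkcond; apply: eq_integral => x _.
  rewrite !patchE !mem_setE !in_itv/=; case: (leP x 0) => //= x0; rewrite ?andbF//.
  by case: leP => //= /ltW/Fle ->; rewrite subrr.
have imu : lebesgue_measure.-integrable `[a, 0] (EFin \o cst (mu A)).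
  exact: (@nonincreasing_itv_integrable _ (cst (mu A))).
have iF (x y : R) : lebesgue_measure.-integrable `[x, y] (EFin \o F) :=
  level_integrable A f x y.
have iFmu : lebesgue_measure.-integrable `[a, 0]
    (EFin \o (fun x => F x - mu A)).
  by apply: (@nonincreasing_itv_integrable _ (fun x => F x - mu A)) => x y xy;
    rewrite lerB// nonincreasing_level.
rewrite -(fineK (integrable_fin_num _ (iF 0 b)))//.
rewrite -(fineK (integrable_fin_num _ iFmu))// -EFinD; congr EFin.
rewrite -/(Rintegral _ _ _) -[X in _ + X]/(Rintegral _ _ _) RintegralB//.
(* The point 0 is negligible: [[0, b]] becomes []0, b]], the complement of [[a, 0]] in [[a, b]]. *)
rewrite Rintegral_cst_itv// -(@Rintegral_itv_obnd_cbnd _ 0 (BRight b)); last first.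
  by apply: integrableS (iF 0 b) => //; apply: subset_itvr; rewrite bnd_simp.
by rewrite -(@Rintegral_itvB _ F (BLeft a) (BRight b) 0) ?bnd_simp//; lra.
Qed.

(** Over [[- M, M]] the level function integrates to a value between 0 and [2 * M * mu A];
    subtracting [M * mu A] centres this range at 0. *)
Lemma choquet_norm_le A f (M : R) : 0 <= M -> (forall t, A t -> `|f t| <= M) ->
  `|fine (choquet mu A f)| <= M * mu A.
Proof.
move=> M0 fM; rewrite (@choquetE _ _ (- M) M) ?oppr_le0//=; last first.
  by move=> t /fM; rewrite ler_norml.
set I := Rintegral _ _ _.
have I0 : 0 <= I by apply: Rintegral_ge0 => x _; exact: setfun_ge0.
have IM : I <= mu A * (M + M).
  have <- : \int[lebesgue_measure]_(x in `[- M, M]) mu A = mu A * (M + M).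
    by rewrite Rintegral_cst_itv ?opprK// ge0_cp.
  apply: le_Rintegral => //; first exact: level_integrable.
    exact: (@nonincreasing_itv_integrable _ (cst (mu A))).
  by move=> x _; exact: level_le.
by rewrite ler_norml mulNr; apply/andP; split; lra.
Qed.

Lemma choquet_leD A f g (M c : R) : 0 <= M -> 0 <= c ->
  (forall t, A t -> `|f t| <= M) -> (forall t, A t -> `|g t| <= M) ->
  (forall t, A t -> f t <= g t + c) ->
  fine (choquet mu A f) <= fine (choquet mu A g) + c * mu A.
Proof.
move=> M0 c0 fM gM fg.
(* The two windows are translates of each other by [c], so their constant terms differ by exactly
   [c * mu A] and only the integrals remain to be compared. *)
rewrite (@choquetE _ f (- M) (M + c)) ?oppr_le0 ?addr_ge0//=; last first.
  by move=> t /fM; rewrite ler_norml => /andP[-> /le_trans]; apply; rewrite lerDl.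
rewrite (@choquetE _ g (- M - c) M) ?subr_le0 //=; last 2 first.
- by rewrite (le_trans _ c0)// oppr_le0.
- move=> t /gM; rewrite ler_norml => /andP[gM1 ->]; rewrite andbT.
  by rewrite (le_trans _ gM1)// gerDl oppr_le0.
suff : \int[lebesgue_measure]_(x in `[- M, M + c]) level A f x <=
    \int[lebesgue_measure]_(x in `[- M - c, M]) level A g x by lra.
have dlg : nonincreasing_fun (fun x => level A g (x - c)).
  by move=> x y xy; apply: nonincreasing_level; rewrite lerD2r.
have -> : \int[lebesgue_measure]_(x in `[- M - c, M]) level A g x =
    \int[lebesgue_measure]_(x in `[- M, M + c]) level A g (x - c).
  congr fine; rewrite [RHS](@ge0_integral_itv_shift _ c)//=.
  - by rewrite addrK; under [RHS]eq_integral do rewrite addrK.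
  - by apply/measurable_EFinP; exact: nonincreasing_measurable.
  - by move=> x; rewrite lee_fin setfun_ge0.
apply: le_Rintegral => //; first exact: level_integrable.
  exact: nonincreasing_itv_integrable.
move=> x _; apply: le_mu => w [Aw xf]; split => //.
by rewrite lerBlDr (le_trans xf)// fg.
Qed.

Lemma choquet_dist_le A f g (M c : R) : 0 <= M -> 0 <= c ->
  (forall t, A t -> `|f t| <= M) -> (forall t, A t -> `|g t| <= M) ->
  (forall t, A t -> `|f t - g t| <= c) ->
  `|fine (choquet mu A f) - fine (choquet mu A g)| <= c * mu A.
Proof.
move=> M0 c0 fM gM fg.
have h1 : fine (choquet mu A f) <= fine (choquet mu A g) + c * mu A.
  apply: choquet_leD M0 c0 fM gM _ => t /fg; rewrite ler_norml => /andP[_].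
  by rewrite lerBlDl.
have h2 : fine (choquet mu A g) <= fine (choquet mu A f) + c * mu A.
  apply: choquet_leD M0 c0 gM fM _ => t /fg; rewrite ler_norml => /andP[+ _].
  by rewrite lerBrDl lerBlDr.
by rewrite ler_norml; apply/andP; split; lra.
Qed.

(** The level functions differ by at most [w] over a window of length [2 * M], and the constant
    terms by at most [M * w]; together this gives the factor 3. The condition on [mu] ranges over
    all [P] so that it applies to every level set of [f]. *)
Lemma choquet_domain_dist_le A B f (M w : R) : 0 <= M -> A `<=` B ->
  (forall t, B t -> `|f t| <= M) ->
  (forall P, mu (B `&` P) <= mu (A `&` P) + w) ->
  `|fine (choquet mu B f) - fine (choquet mu A f)| <= M * w *+ 3.
Proof.
move=> M0 AB fM BA.
have w0 : 0 <= w by have := BA set0; rewrite !setI0 lerDl.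
rewrite !(@choquetE _ f (- M) M) ?oppr_le0//=; last 2 first.
- by move=> t /AB/fM; rewrite ler_norml.
- by move=> t /fM; rewrite ler_norml.
set J := Rintegral _ _ _; set I := Rintegral _ _ _.
have IJ : I <= J.
  apply: le_Rintegral => //; do ?exact: level_integrable.
  by move=> x _; apply: le_mu => t [/AB].
have JI : J <= I + w * (M + M).
  have <- : \int[lebesgue_measure]_(x in `[- M, M]) w = w * (M + M).
    by rewrite Rintegral_cst_itv ?opprK// ge0_cp.
  have dAw : nonincreasing_fun (fun x => level A f x + w).
    by move=> x y xy; rewrite lerD2r nonincreasing_level.
  rewrite -RintegralD//; last 2 first.
  - exact: level_integrable.
  - exact: (@nonincreasing_itv_integrable _ (cst w)).
  apply: le_Rintegral => //; first exact: level_integrable.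
  + exact: nonincreasing_itv_integrable.
  + by move=> x _; exact: (BA [set t | x <= f t]).
have mAB : mu A <= mu B by exact: le_mu.
have mBA : mu B <= mu A + w by have := BA setT; rewrite !setIT.
have := ler_wpM2l M0 mAB; have := ler_wpM2l M0 mBA; rewrite mulrDr => h1 h2.
by rewrite ler_norml !mulNr; apply/andP; split; nra.
Qed.

End choquet_bounded.

(** * Compactness in C[0,1]: the Arzela-Ascoli theorem *)

Lemma compact_set_type (X : topologicalType) (A : set X) :
  compact A -> compact [set: A].
Proof.
move=> cA F FF _.
have FA : (val @ F : set_system X) A.
  by apply: (@filterS _ F _ setT) => [[x xA] _|]; [exact: set_mem|exact: filterT].
have [p [Ap clp]] := cA (val @ F) _ FA.
(* Open sets of the subset topology are preimages of open sets [W] of [X], so a cluster point of the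
   pushed-forward filter is also one of [F]. *)
exists (exist _ p (mem_set Ap)); split => // P Q FP [_ [[W oW <-] Wp WQ]].
have FvP : (val @ F : set_system X) (val @` P) by apply: (@filterS _ F _ P) => // a; exists a.
have [_ [[a Pa <-] Wa]] := clp _ _ FvP (open_nbhs_nbhs (conj oW Wp)).
by exists a; split => //; exact: WQ.
Qed.

Section C01_space.
Context (R : realType).
Implicit Types (f g : C01 R) (W : set (C01 R)).

Definition zero01 : I01 R.
Proof. by exists 0; apply/mem_set; rewrite /= in_itv /= lexx ler01. Defined.

Lemma C01_dist_le f g (r : R) : (forall x, `|f x - g x| <= r) -> mdist f g <= r.
Proof.
by move=> fg; apply: ge_sup => [|_ [x _ <-]//]; exists `|f zero01 - g zero01|, zero01.
Qed.

Lemma closure_C01 W f (e : R) : closure W f -> 0 < e ->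
  exists2 g, W g & forall x, `|f x - g x| < e.
Proof.
move=> cf e0; have [g [Wg]] := cf _ (nbhsx_ballx f e e0).
rewrite ballEmdist/= => fg; exists g => // x.
by apply: le_lt_trans fg; exact: C01_dist_ge.
Qed.

(** An ultrafilter on the closure converges pointwise, since values stay in the compact [[- B, B]].
    Equicontinuity makes the limit continuous, and compactness of [0,1] makes the convergence
    uniform. *)
Lemma ascoli_C01 W (B : R) :
  (forall f x, W f -> `|f x| <= B) ->
  (forall x (e : R), 0 < e ->
    \forall y \near x, forall f, W f -> `|f x - f y| <= e) ->
  compact (closure W).
Proof.
move=> WB We; rewrite compact_ultra => F FU FW.
have cWB f x : closure W f -> `|f x| <= B.
  move=> cf; apply/ler_addgt0Pr => e e0.
  have [g Wg fg] := closure_C01 _ _ _ cf e0.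
  rewrite -[f x](subrK (g x)) addrC (le_trans (ler_normD _ _))//.
  by rewrite lerD ?WB// ltW.
have cWe x (e : R) : 0 < e ->
    \forall y \near x, forall f, closure W f -> `|f x - f y| <= e.
  move=> e0; have e4 : 0 < e / 4 by rewrite divr_gt0.
  have e2 : 0 < e / 2 by rewrite divr_gt0.
  apply: filterS (We x _ e2) => y Wxy f cf.
  have [g Wg fg] := closure_C01 _ _ _ cf e4.
  have := Wxy g Wg; have := fg x; have := fg y.
  by rewrite !ltr_norml !ler_norml => /andP[? ?] /andP[? ?] /andP[? ?];
    apply/andP; split; lra.
have /choice[h Fh] : forall x, exists p : R, (fun f : C01 R => f x) @ F --> p.
  move=> x; pose ev := fun f : C01 R => f x.
  have FB : (ev @ F : set_system R) `[- B, B]%classic.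
    by apply: (@filterS _ F _ _ (ev @^-1` _) _ FW) => f /(cWB f x); rewrite /= in_itv/= ler_norml.
  have [p [_ clp]] := @segment_compact R (- B) B _ _ FB.
  (* A cluster point of an ultrafilter is a limit: otherwise the complement of some neighbourhood of
     [p] would be in the filter, yet have to meet that neighbourhood. *)
  exists p => U pU; have [//|FnU] := in_ultra_setVsetC (ev @^-1` U) FU.
  by have [y []] := clp (~` U) U FnU pU.
have Fhe x (e : R) : 0 < e -> F [set f : C01 R | `|h x - f x| < e].
  by move=> e0; have /cvgrPdist_lt := Fh x; exact.
have hc : continuous h.
  move=> x; apply/(@cvgrPdist_le _ _ _ _ (nbhs_filter x)) => e e0.
  have e3 : 0 < e / 3 by rewrite divr_gt0.
  apply: filterS (cWe x _ e3) => y cWxy.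
  have [f [[/cWxy fxy hx] hy]] := filter_ex (filterI (filterI FW (Fhe x _ e3)) (Fhe y _ e3)).
  move: fxy hx hy => /=; by rewrite !ltr_norml !ler_norml => /andP[? ?] /andP[? ?] /andP[? ?];
    apply/andP; split; lra.
pose H : C01 R := (mkcts hc : continuousType (I01 R) R).
have FH : F --> H.
  apply/metricType_numDomainType.fcvgrPdist_lt => e e0.
  have e3 : 0 < e / 3 by rewrite divr_gt0.
  have e6 : 0 < e / 6 by rewrite divr_gt0.
  have /compact_near_coveringP cI : compact [set: I01 R].
    exact/compact_set_type/segment_compact.
  (* Compactness as near-covering: a property holding for [y] near each [x] jointly with [F]-most
     [f] holds for [F]-most [f] at all points at once. Going from [h y] to [f y] through [h x] and
     [f x] costs three times [e / 6]. *)
  have : F [set f : C01 R | [set: I01 R] `<=` [set x | `|h x - f x| <= e / 2]].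
    apply: cI => x _; exists ([set y | (forall f, closure W f -> `|f x - f y| <= e / 6)
      /\ `|h x - h y| < e / 6], [set f : C01 R | closure W f /\ `|h x - f x| < e / 6]).
      split; apply: filterI => //=; [exact: cWe| |exact: Fhe].
      by have /cvgrPdist_lt := hc x; exact.
    move=> [y f]/= [[cWy hy] [/cWy + +]]; move: hy.
    rewrite !ltr_norml !ler_norml => /andP[? ?] /andP[? ?] /andP[? ?];
      apply/andP; split; lra.
  (* The distance is a supremum, so pointwise bounds yield only a weak inequality; [e / 2] leaves
     room for the strict one. *)
  apply: filterS => f hf; apply: (@le_lt_trans _ _ (e / 2)); last by lra.
  by apply: C01_dist_le => x; exact: hf.
exists H; split => //; apply: closed_closure => U HU.
exact: filter_ex (filterI FW (FH _ HU)).
Qed.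

End C01_space.

(** * Lebesgue outer measure of subsets of [0,1] *)

Lemma le_lebesgue_measure (R : realType) (A B : set R) :
  A `<=` B -> (lebesgue_measure A <= lebesgue_measure B)%E.
Proof.
move=> AB.
by rewrite /lebesgue_measure /lebesgue_stieltjes_measure /measure_extension
  le_outer_measure.
Qed.

Lemma lebesgue_measureU2 (R : realType) (A B : set R) :
  (lebesgue_measure (A `|` B) <= lebesgue_measure A + lebesgue_measure B)%E.
Proof.
by rewrite /lebesgue_measure /lebesgue_stieltjes_measure /measure_extension
  outer_measureU2.
Qed.

Section lebesgue_I01.
Context (R : realType).
Implicit Types (A B P : set (I01 R)) (x y : I01 R).
Local Notation m A := (fine (lebesgue_measure [set val t | t in A])).

Lemma I01_ge0 x : 0 <= val x.
Proof. by case: x => x /= /set_mem; rewrite /= in_itv/= => /andP[]. Qed.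

Lemma I01_le1 x : val x <= 1.
Proof. by case: x => x /= /set_mem; rewrite /= in_itv/= => /andP[]. Qed.

Lemma I01_measure_le A (a b : R) : a <= b ->
  (forall t, A t -> a <= val t <= b) ->
  (lebesgue_measure [set val t | t in A] <= (b - a)%:E)%E.
Proof.
move=> ab Aab; have -> : (b - a)%:E = lebesgue_measure `[a, b]%classic.
  by rewrite lebesgue_measure_itv/= lte_fin; case: ltgtP ab => //= -> _;
    rewrite subrr.
by apply: le_lebesgue_measure => _ [t /Aab + <-]; rewrite /= in_itv.
Qed.

Lemma I01_measure_fin A : lebesgue_measure [set val t | t in A] \is a fin_num.
Proof.
rewrite ge0_fin_numE//; apply: le_lt_trans (ltry (1 - 0)).
by apply: I01_measure_le => // t _; rewrite I01_ge0 I01_le1.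
Qed.

Lemma I01_measure_ge0 A : 0 <= m A.
Proof. by rewrite fine_ge0. Qed.

Lemma I01_measure_fine_le A (b : R) : 0 <= b ->
  (forall t, A t -> val t <= b) -> m A <= b.
Proof.
move=> b0 Ab; rewrite -lee_fin fineK ?I01_measure_fin// -[b]subr0.
by apply: I01_measure_le => // t /Ab ->; rewrite I01_ge0.
Qed.

Lemma I01_measure_le1 A : m A <= 1.
Proof. by apply: I01_measure_fine_le => // t _; exact: I01_le1. Qed.

Lemma I01_measureS A B : A `<=` B -> m A <= m B.
Proof.
move=> AB; rewrite fine_le ?I01_measure_fin//.
by apply: le_lebesgue_measure => _ [t /AB Bt <-]; exists t.
Qed.

(** The points gained lie in the segment from [val x] to [val y]; subadditivity of the outer measure
    concludes. *)
Lemma I01_measure_extend P x y : val x <= val y ->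
  m ([set t | val t <= val y] `&` P) <=
  m ([set t | val t <= val x] `&` P) + (val y - val x).
Proof.
move=> xy; rewrite -lee_fin EFinD !fineK ?I01_measure_fin//.
apply: (@le_trans _ _ (lebesgue_measure
  ([set val t | t in [set t | val t <= val x] `&` P] `|`
   [set val t | t in [set t | val x <= val t <= val y]]))).
  apply: le_lebesgue_measure => _ [t [ty Pt] <-].
  have [tx|/ltW xt] := leP (val t) (val x); first by left; exists t.
  by right; exists t => //=; rewrite xt.
apply: (le_trans (lebesgue_measureU2 _ _ _)); apply: leeD => //.
exact: I01_measure_le.
Qed.

End lebesgue_I01.

(** * The distorted measure and its Volterra-Choquet operator *)

Section distorted.
Context (R : realType) (gamma : R -> R).
Hypotheses (gamma_ndecr : {in `[0, 1] &, {homo gamma : s t / s <= t}})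
  (gamma_concave : concave_function `[0, 1]%classic gamma)
  (gamma_cont : {within `[0, 1], continuous gamma})
  (gamma0 : gamma 0 = 0).
Local Notation mu := (distorted_lebesgue gamma).
Local Notation upto x := [set t : I01 R | val t <= val x].

(** Both [s] and [h] are convex combinations of 0 and [s + h], with weights [r] and [1 - r] on
    [s + h]. Concavity gives [r * gamma (s + h) <= gamma s] and
    [(1 - r) * gamma (s + h) <= gamma h], which add up. *)
Lemma gamma_subadditive (s h : R) : 0 <= s -> 0 <= h -> s + h <= 1 ->
  gamma (s + h) <= gamma s + gamma h.
Proof.
move=> s0 h0 sh1; have [->|s_neq0] := eqVneq s 0; first by rewrite add0r gamma0 add0r.
have sh0 : 0 < s + h by rewrite ltr_wpDr// lt_neqAle eq_sym s_neq0.
pose r := s / (s + h).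
have r01 : 0 <= r <= 1.
  by rewrite divr_ge0 ?(ltW sh0)//= ler_pdivrMr// mul1r lerDl.
have rC : 1 - r = h / (s + h).
  by rewrite -[1](@divff _ (s + h)) ?gt_eqF// -mulrBl addrAC subrr add0r.
have I0 : (0 : R) \in `[0, 1]%classic by rewrite inE/= in_itv/= lexx ler01.
have Ish : s + h \in `[0, 1]%classic by rewrite inE/= in_itv/= sh1 ltW.
have gC (t : {i01 R}) (a b : R) : a \in `[0, 1]%classic -> b \in `[0, 1]%classic ->
    t%:num * gamma a + (1 - t%:num) * gamma b <= gamma (t%:num * a + (1 - t%:num) * b).
  by move=> a01 b01; exact: (gamma_concave t a b).
have := gC (Itv01 (andP r01).1 (andP r01).2) _ _ Ish I0.
have := gC (Itv01 (andP r01).1 (andP r01).2) _ _ I0 Ish.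
rewrite /= gamma0 !mulr0 add0r addr0 rC divfK ?gt_eqF// /r divfK ?gt_eqF// addr0 add0r.
rewrite -rC /r; move: (s / (s + h)) => q; lra.
Qed.

Lemma distorted0 : mu set0 = 0.
Proof. by rewrite /distorted_lebesgue image_set0 measure0. Qed.

Let m01 (A : set (I01 R)) : fine (lebesgue_measure [set val t | t in A]) \in `[0, 1].
Proof. by rewrite in_itv/= I01_measure_ge0 I01_measure_le1. Qed.

Lemma le_distorted : {homo mu : X Y / X `<=` Y >-> X <= Y}.
Proof. by move=> X Y XY; apply: gamma_ndecr => //; exact: I01_measureS. Qed.

(** Supplies the condition of [choquet_domain_dist_le] with [w] equal to [gamma (val y - val x)]. *)
Lemma distorted_extend (P : set (I01 R)) (x y : I01 R) : val x <= val y ->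
  mu (upto y `&` P) <= mu (upto x `&` P) + gamma (val y - val x).
Proof.
move=> xy; have mx := I01_measure_ge0 _ (upto x `&` P).
have h0 : 0 <= val y - val x by rewrite subr_ge0.
(* The part up to [x] measures at most [val x], so the sum stays in [0,1], where [gamma] is
   controlled. *)
have mxh : fine (lebesgue_measure [set val t | t in upto x `&` P]) +
    (val y - val x) <= 1.
  apply: (@le_trans _ _ (val x + (val y - val x))).
    by rewrite lerD2r I01_measure_fine_le ?I01_ge0// => t [].
  by rewrite addrC subrK I01_le1.
apply: le_trans (gamma_subadditive _ _ mx h0 mxh).
apply: gamma_ndecr; rewrite ?m01//; last exact: I01_measure_extend.
by rewrite in_itv/= mxh addr_ge0.
Qed.

Lemma gamma_ge0 (h : R) : 0 <= h -> h <= 1 -> 0 <= gamma h.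
Proof.
by move=> h0 h1; rewrite -gamma0 gamma_ndecr ?in_itv/= ?lexx ?ler01 ?h0.
Qed.

Lemma gamma_small (e : R) : 0 < e ->
  exists2 d, 0 < d & forall h, 0 <= h -> h <= 1 -> h < d -> gamma h <= e.
Proof.
move=> e0; have [_ + _] := (continuous_within_itvP gamma ltr01).1 gamma_cont.
rewrite gamma0 => /cvgrPdist_le/(_ e e0)[d /= d0 gd]; exists d => // h h0 h1 hd.
(* The right-hand limit at 0 says nothing about 0 itself. *)
have [->|hn0] := eqVneq h 0; first by rewrite gamma0 ltW.
have := gd h; rewrite /= !sub0r !normrN (ger0_norm h0) (ger0_norm (gamma_ge0 _ h0 h1)).
by apply => //; rewrite lt_neqAle eq_sym hn0.
Qed.

Lemma distorted_le A : mu A <= gamma 1.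
Proof.
by apply: gamma_ndecr; rewrite ?m01// ?in_itv/= ?lexx ?ler01 ?I01_measure_le1.
Qed.

(** [fine] would send an infinite value to 0; [volterra_choquetE] excludes this for bounded [f]. *)
Definition volterra_choquet (f : I01 R -> R) (x : I01 R) : R :=
  fine (choquet mu (upto x) f).
Local Notation V := volterra_choquet.

Lemma volterra_choquetE (f : I01 R -> R) (K : R) (x : I01 R) : 0 <= K ->
  (forall t, `|f t| <= K) -> (V f x)%:E = choquet mu (upto x) f.
Proof.
move=> K0 fK; rewrite /V.
rewrite (@choquetE _ _ _ distorted0 le_distorted _ f (- K) K) ?oppr_le0//.
by move=> t _; rewrite -ler_norml.
Qed.

Lemma volterra_choquet_norm_le (f : I01 R -> R) (K : R) (x : I01 R) : 0 <= K ->
  (forall t, `|f t| <= K) -> `|V f x| <= K * gamma 1.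
Proof.
move=> K0 fK; apply: (@le_trans _ _ (K * mu (upto x))).
  by apply: choquet_norm_le => //; [exact: distorted0|exact: le_distorted].
by rewrite ler_wpM2l// distorted_le.
Qed.

Lemma volterra_choquet_lipschitz (f g : I01 R -> R) (K c : R) (x : I01 R) :
  0 <= K -> 0 <= c -> (forall t, `|f t| <= K) -> (forall t, `|g t| <= K) ->
  (forall t, `|f t - g t| <= c) -> `|V f x - V g x| <= c * gamma 1.
Proof.
move=> K0 c0 fK gK fg; apply: (@le_trans _ _ (c * mu (upto x))).
  by apply: (@choquet_dist_le _ _ _ distorted0 le_distorted _ _ _ K).
by rewrite ler_wpM2l// distorted_le.
Qed.

Lemma volterra_choquet_modulus (f : I01 R -> R) (K : R) (x y : I01 R) :
  0 <= K -> (forall t, `|f t| <= K) ->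
  `|V f x - V f y| <= K * gamma `|val x - val y| *+ 3.
Proof.
move=> K0 fK; wlog xy : x y / val y <= val x => [hw|].
  have [/ltW xy|] := ltP (val x) (val y); last exact: hw.
  by rewrite distrC [`|val x - _|]distrC hw.
rewrite (ger0_norm (_ : 0 <= val x - val y)) ?subr_ge0//.
apply: choquet_domain_dist_le => //; [exact: distorted0|exact: le_distorted| |].
- by move=> t /= /le_trans; exact.
- by move=> P; exact: distorted_extend.
Qed.

Lemma volterra_choquet_equicontinuous (K : R) (x : I01 R) (e : R) :
  0 <= K -> 0 < e ->
  \forall y \near x, forall f : I01 R -> R, (forall t, `|f t| <= K) ->
    `|V f x - V f y| <= e.
Proof.
(* The added 1 keeps the divisor positive when [K] is 0. *)
move=> K0 e0; have K3 : 0 < K *+ 3 + 1 by rewrite ltr_wpDl// mulrn_wge0.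
have [d d0 gd] := gamma_small (e / (K *+ 3 + 1)) (divr_gt0 e0 K3).
have : \forall y \near x, `|val x - val y| < d.
  have : (val : I01 R -> R) @ x --> val x by exact: initial_continuous.
  by move/(@cvgrPdist_lt _ _ _ _ (nbhs_filter x)); exact.
apply: filterS => y xyd f fK.
apply: (le_trans (volterra_choquet_modulus _ _ _ _ K0 fK)).
have xy1 : `|val x - val y| <= 1.
  have := I01_ge0 _ x; have := I01_ge0 _ y; have := I01_le1 _ x; have := I01_le1 _ y.
  by rewrite ler_norml => *; apply/andP; split; lra.
have gxy := gd _ (normr_ge0 _) xy1 xyd.
rewrite -mulrnAl (le_trans (ler_wpM2l _ gxy)) ?mulrn_wge0//.
by rewrite mulrCA ler_piMr ?(ltW e0)// ler_pdivrMr// mul1r lerDl.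
Qed.

Lemma volterra_choquet_continuous (f : I01 R -> R) (K : R) : 0 <= K ->
  (forall t, `|f t| <= K) -> continuous (V f).
Proof.
move=> K0 fK x; apply/(@cvgrPdist_le _ _ _ _ (nbhs_filter x)) => e e0.
by apply: filterS (volterra_choquet_equicontinuous K x e K0 e0) => y; exact.
Qed.

End distorted.

(** * Continuity and compactness of the operator on C[0,1] *)

Lemma C01_norm_le (R : realType) (f : C01 R) (t : I01 R) :
  `|f t| <= mdist f (cst 0 : continuousType (I01 R) R).
Proof.
by rewrite -[f t]subr0; exact: (C01_dist_ge f (cst 0 : continuousType _ _)).
Qed.

Theorem corollary5p4 (R : realType) (gamma : R -> R)
    (gamma_ndecr : {in `[0, 1] &, {homo gamma : s t / s <= t}})
    (gamma_concave : concave_function `[0, 1]%classic gamma)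
    (gamma_cont : {within `[0, 1], continuous gamma})
    (gamma0 : gamma 0 = 0) :
  exists V : C01 R -> C01 R,
    (forall (f : C01 R) (x : I01 R),
       (V f x)%:E =
       choquet (distorted_lebesgue gamma) [set t | val t <= val x] f) /\
    compact_operator V.
Proof.
pose z : C01 R := (cst 0 : continuousType (I01 R) R).
have Vc (f : C01 R) : continuous (volterra_choquet _ gamma f).
  apply: volterra_choquet_continuous (mdist_ge0 f z) _ => //; exact: C01_norm_le.
pose V f : C01 R := (mkcts (Vc f) : continuousType (I01 R) R).
have g1 : 0 <= gamma 1 by exact: gamma_ge0.
exists V; split=> [f x|].
  apply: volterra_choquetE (mdist_ge0 f z) _ => //; exact: C01_norm_le.
split=> [f|M [r Mr]].
  apply/(@metricType_numDomainType.cvgrPdist_lt _ _ _ _ (nbhs_filter f)) => e e0.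
  have g1p : 0 < gamma 1 + 1 by rewrite ltr_wpDl.
  have : nbhs f [set g | mdist f g < e / (gamma 1 + 1)].
    by rewrite -ballEmdist; apply: nbhsx_ballx; rewrite divr_gt0.
  apply: filterS => g fg; apply: (@le_lt_trans _ _ (mdist f g * gamma 1)).
    apply: C01_dist_le => x.
    (* The sum of the two norms serves as a common bound for [f] and [g]; it does not enter the
       Lipschitz constant [gamma 1]. *)
    apply: (@volterra_choquet_lipschitz _ _ gamma_ndecr gamma0 f g (mdist f z + mdist g z)).
    - by rewrite addr_ge0 ?mdist_ge0.
    - exact: mdist_ge0.
    - by move=> t; rewrite (le_trans (C01_norm_le _ f t))// lerDl mdist_ge0.
    - by move=> t; rewrite (le_trans (C01_norm_le _ g t))// lerDr mdist_ge0.
    - by move=> t; exact: C01_dist_ge.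
  move: fg; rewrite /= ltr_pdivlMr// => fg; apply: le_lt_trans fg.
  by rewrite ler_wpM2l ?mdist_ge0// lerDl.
(* Boundedness of [M] limits only mutual distances; passing through one member of [M] to the zero
   function [z] turns it into a uniform bound. *)
have [K K0 MK] : exists2 K, 0 <= K & forall f t, M f -> `|f t| <= K.
  have [[f Mf]|M0] := pselect (M !=set0); last first.
    by exists 0 => // f t Mf; case: M0; exists f.
  exists (r + mdist f z) => [|g t Mg].
    by rewrite addr_ge0 ?mdist_ge0// (le_trans _ (Mr f f Mf Mf)) ?mdist_ge0.
  apply: le_trans (C01_norm_le _ g t) _.
  by apply: le_trans (metric_triangle g f z) _; rewrite lerD2r Mr.
apply: (@ascoli_C01 _ _ (K * gamma 1)) => [_ x [f Mf <-]|x e e0].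
  by apply: volterra_choquet_norm_le => // t; exact: MK.
apply: filterS (volterra_choquet_equicontinuous _ _ gamma_ndecr gamma_concave
  gamma_cont gamma0 K x e K0 e0).
by move=> y xy _ [f Mf <-]; apply: xy => t; exact: MK.
Qed.
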